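(* Let $L\ge 1$ be an integer, let $a_1,\dots,a_L$ be distinct complex numbers, let $n_1,\dots,n_L\ge 0$ be integers, and let $$h(z)=\frac{1}{(z-a_1)^{n_1+1}(z-a_2)^{n_2+1}\cdots(z-a_L)^{n_L+1}} .$$ Let $z\in\mathbb{C}$ be a point which is not a pole of $h$ (i.e. $z\ne a_i$ for all $i$), and let $s_1,\dots,s_L,s\in\mathbb{C}$ (where $s=s(z)$ may depend on $z$) be such that $s\neq 0$ and, for each $i$, $s_i=0$ if and only if $n_i=0$. Let $t\ge 0$ be an integer, and let $h^{(t)}$ denote the $t$-th derivative of $h$. With $\Theta_1(j,r,p)$ and $\Theta_2(r,p)$ as defined in the context, the following hold. (I) For every integer $N\ge t+1$, provided all denominators occurring in the formula below are nonzero, that is, $(z-a_m)(js-ps_r)-(z-a_r)(js-qs_m)\neq 0$ for all $1\le j\le N$, $1\le r,m\le L$ with $m\ne r$, $0\le p\le n_r$, $0\le q\le n_m$, one has $$h^{(t)}(z)=\frac{t!}{s^{t}}(-1)^{N+t}\sum_{j=1}^{N}\left(\frac{j^{N-t}}{j!(N-j)!}(-1)^{j}\sum_{r=1}^{L}\left(\frac{1}{s_r^{n_r}(z-a_r)^{n_r+1+t}}\sum_{p=0}^{n_r}\Theta_1(j,r,p)\right)\right).$$ (II) If $\left(\sum_{m=1}^{L}n_m\right)+t\ge 1$, and provided all denominators occurring in the formula below are nonzero, that is, $(z-a_m)(js-ps_r)-(z-a_r)(js-qs_m)\neq 0$ for all $1\le j\le t$, $1\le r,m\le L$ with $m\neq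 r$, $0\le p\le n_r$, $0\le q\le n_m$, and $qs_m(z-a_r)-ps_r(z-a_m)\ne 0$ for all $1\le r,m\le L$ with $m\ne r$, $1\le p\le n_r$, $1\le q\le n_m$, one has $$\begin{aligned}h^{(t)}(z)={}&\frac{1}{s^{t}}\left(\prod_{m=1}^{L}\frac{1}{z-a_m}\right)(-1)^{\left(\sum_{m=1}^{L}n_m\right)+t}\sum_{\substack{1\le r\le L\\ n_r\ge 1}}\left(s_r^{\left(\sum_{m\ne r}n_m\right)+t}\cdot\frac{1}{(z-a_r)^{n_r+t}}\sum_{p=1}^{n_r}\Theta_2(r,p)\right)\\&+\frac{t!}{s^{t}}\sum_{j=1}^{t}\left(\frac{(-1)^{j}}{j!(t-j)!}\sum_{r=1}^{L}\left(\frac{1}{s_r^{n_r}(z-a_r)^{n_r+1+t}}\sum_{p=0}^{n_r}\Theta_1(j,r,p)\right)\right),\end{aligned}$$ where $\sum_{m\ne r}n_m$ denotes $\sum_{1\le m\le L,\,m\neq r}n_m$.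
   Context: For an integer $j\ge 1$, $1\le r\le L$ and $0\le p\le n_r$, set $$\Theta_1(j,r,p):=\frac{(js-ps_r)^{\left(\sum_{m=1}^{L}n_m\right)+L-1+t}}{p!\,(n_r-p)!}(-1)^{p}\prod_{\substack{1\le m\le L\\ m\neq r}}\left(\prod_{q=0}^{n_m}\frac{1}{(z-a_m)(js-ps_r)-(z-a_r)(js-qs_m)}\right).$$ For $1\le r\le L$ with $n_r\ge 1$ and $1\le p\le n_r$, set $$\Theta_2(r,p):=\frac{p^{\left(\sum_{m=1}^{L}n_m\right)+t}}{p!\,(n_r-p)!}(-1)^{p}\prod_{\substack{1\le m\le L\\ m\neq r}}\left(\prod_{q=1}^{n_m}\frac{1}{qs_m(z-a_r)-ps_r(z-a_m)}\right).$$ These depend also on $z,t,a_i,n_i,s_i,s$. Conventions: $h^{(0)}=h$; $0^0=1$ (for example $s_r^{n_r}=1$ if $n_r=0$); a sum over an empty range is $0$; a product over an empty range is $1$. *)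

(* Defs.v *)
From HB Require Import structures.
From mathcomp Require Import all_boot all_order all_algebra.
From mathcomp Require Import complex.
From mathcomp Require Import all_classical all_reals all_analysis.

Set Implicit Arguments.
Unset Strict Implicit.
Unset Printing Implicit Defensive.

Import Order.TTheory GRing.Theory Num.Theory numFieldNormedType.Exports.

Local Open Scope ring_scope.

(* The indices 1..L of the mathematics are the elements of 'I_L.  The ring
   power satisfies 0 ^+ 0 = 1 and 0^-1 = 0; the latter matters in [hfun] only
   at its poles. *)

Section Definitions.
Variables (F : fieldType) (L : nat).
Implicit Types (a sv : 'I_L -> F) (n : 'I_L -> nat).

Definition hfun a n (w : F) : F := 1 / \prod_(i < L) (w - a i) ^+ (n i).+1.

Definition Theta1 a n sv (s z : F) (t j : nat) (r : 'I_L) (p : nat) : F :=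
  (j%:R * s - p%:R * sv r) ^+ ((\sum_(m < L) n m) + L - 1 + t)%N
    / (p`!%:R * (n r - p)`!%:R) * (-1) ^+ p
  * \prod_(m < L | m != r) \prod_(0 <= q < (n m).+1)
      (1 / ((z - a m) * (j%:R * s - p%:R * sv r)
            - (z - a r) * (j%:R * s - q%:R * sv m))).

Definition Theta2 a n sv (z : F) (t : nat) (r : 'I_L) (p : nat) : F :=
  p%:R ^+ ((\sum_(m < L) n m) + t)%N
    / (p`!%:R * (n r - p)`!%:R) * (-1) ^+ p
  * \prod_(m < L | m != r) \prod_(1 <= q < (n m).+1)
      (1 / (q%:R * sv m * (z - a r) - p%:R * sv r * (z - a m))).

End Definitions.

(* Main.v *)
(* Write H_t for the complete homogeneous symmetric polynomial of degree t.  From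
   the generating function of H_t, h^(t)(z) = (-1)^t t! h(z) H_t(1/(z - a_r)), each
   1/(z - a_r) being repeated n_r + 1 times.  For pairwise distinct x_1, ..., x_M,
   H_t(x) = sum_i x_i^(M-1+t) / prod_(k != i) (x_i - x_k); at the nodes
   x_(r,p) = (j s - p s_r) / (z - a_r) this says that the inner double sum over
   Theta_1 equals h(z) P(j), where P(j) = H_t(x) is a polynomial in j of degree at
   most t with leading coefficient s^t H_t(1/(z - a_r)).  The alternating sum over j
   in (I) extracts the coefficient of degree N from j^(N-t) P(j).  In (II) one takes
   N = t, so that the term j = 0 no longer vanishes; in P(0) the nodes with p = 0
   are zero and drop out of H_t, and the same identity for the remaining
   n_1 + ... + n_L nodes gives the sum over Theta_2. *)

Require Import Defs.
From HB Require Import structures.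
From mathcomp Require Import all_boot all_order all_algebra.
From mathcomp Require Import complex.
From mathcomp Require Import all_classical all_reals all_analysis.
From mathcomp Require Import ring zify.

Set Implicit Arguments.
Unset Strict Implicit.
Unset Printing Implicit Defensive.

Import Order.TTheory GRing.Theory Num.Theory numFieldNormedType.Exports.

Local Open Scope ring_scope.

(* The complete homogeneous symmetric polynomial of degree [t] in the entries of
   [l], expanded along the exponent [t - k] of the first entry. *)
Fixpoint hsym (T : pzRingType) (l : seq T) (t : nat) : T :=
  if l is x :: l' then \sum_(k < t.+1) x ^+ (t - k) * hsym l' k
  else (t == 0)%:R.

(** * Identities for complete homogeneous symmetric polynomials *)

Lemma hsym0 (T : pzRingType) (l : seq T) : hsym l 0 = 1.
Proof. by elim: l => //= x l IH; rewrite big_ord1 subnn expr0 mul1r. Qed.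

(** A monomial of degree t + 1 either contains x, which factors out, or involves only [l]. The later
    inductions on the degree rest on this recursion. *)
Lemma hsymS (T : pzRingType) (x : T) (l : seq T) (t : nat) :
  hsym (x :: l) t.+1 = x * hsym (x :: l) t + hsym l t.+1.
Proof.
rewrite /= big_ord_recr /= subnn expr0 mul1r; congr (_ + _).
rewrite mulr_sumr; apply: eq_bigr => k _.
by rewrite mulrA -exprS subSn // -ltnS.
Qed.

Lemma rmorph_hsym (T U : pzRingType) (f : {rmorphism T -> U}) (l : seq T)
    (t : nat) : f (hsym l t) = hsym (map f l) t.
Proof.
elim: l t => [|x l IH] t /=; first by rewrite rmorph_nat.
rewrite rmorph_sum; apply: eq_bigr => k _.
by rewrite rmorphM rmorphXn IH.
Qed.

Lemma hsym_scale (T : comPzRingType) (c : T) (l : seq T) (t : nat) :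
  hsym [seq c * x | x <- l] t = c ^+ t * hsym l t.
Proof.
elim: l t => [|x l IH] t.
  by case: t => [|t] /=; rewrite ?expr0 ?mulr1 ?mulr0.
rewrite [X in hsym X]/=; elim: t => [|t IHt]; first by rewrite !hsym0 expr0 mulr1.
by rewrite !hsymS IH IHt exprS; ring.
Qed.

Lemma hsym_filter0 (T : pzRingType) (l : seq T) (t : nat) :
  hsym [seq x <- l | x != 0] t = hsym l t.
Proof.
elim: l t => [//|x l IH] t /=.
case: eqP => [->|_] /=; last by under eq_bigr do rewrite IH.
rewrite big_ord_recr /= subnn expr0 mul1r big1 ?add0r ?IH// => k _.
by rewrite expr0n subn_eq0 leqNgt ltn_ord mul0r.
Qed.

(** Both claims go through one induction: in [hsymS] the constant term u.2 multiplies the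
    coefficient of degree t + 1 of a polynomial of degree at most t, which is zero by the size
    bound. *)
Lemma coef_hsym_affine (F : idomainType) (l : seq (F * F)) (t : nat) :
  (size (hsym [seq u.1 *: 'X + u.2%:P | u <- l] t)%R <= t.+1)%N
  /\ (hsym [seq u.1 *: 'X + u.2%:P | u <- l] t)`_t = hsym [seq u.1 | u <- l] t.
Proof.
elim: l t => [|u l IH] t.
  rewrite /= -polyC_natr coefC size_polyC.
  by case: t => [|t] //=; rewrite ?oner_neq0 ?eqxx.
rewrite 2![map _ (_ :: _)]/=; elim: t => [|t [IHs IHc]].
  by rewrite !hsym0 coef1 size_poly1.
have [sl cl] := IH t.+1.
rewrite !hsymS mulrDl -scalerAl mulrC mul_polyC; split.
  apply: (leq_trans (size_polyD _ _)); rewrite geq_max sl andbT.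
  apply: (leq_trans (size_polyD _ _)); rewrite geq_max.
  apply/andP; split; apply: (leq_trans (size_scale_leq _ _)).
    by rewrite (leq_trans (size_polyMleq _ _)) // size_polyX addn2.
  exact: leq_trans IHs _.
rewrite !coefD !coefZ coefMX /= IHc cl.
by rewrite [nth _ _ _](nth_default 0 IHs) mulr0 addr0.
Qed.

(** * Lagrange interpolation *)

Section Interpolation.
Variables (F : fieldType) (I : eqType).
Implicit Types (l : seq I) (x : I -> F).

(** The interpolant [q] agrees with [p] at all nodes and both have degree below the number of nodes,
    so they coincide. The sum is the top coefficient of [q], as the basis polynomials [w i] are
    monic. *)
Lemma lagrange_lead l x (p : {poly F}) :
    uniq l -> {in l &, injective x} -> (size p <= size l)%N ->
  \sum_(i <- l) p.[x i] / \prod_(j <- l | j != i) (x i - x j)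
    = p`_(size l).-1.
Proof.
move=> ul xinj sp.
pose w i := \prod_(j <- l | j != i) ('X - (x j)%:P).
have wE i : i \in l -> size (w i) = size l.
  move=> il; rewrite /w -big_filter size_prod_XsubC -rem_filter // size_rem //.
  by rewrite prednK //; case: l il {ul xinj sp w}.
have w_neq0 i : i \in l -> \prod_(j <- l | j != i) (x i - x j) != 0.
  move=> il; rewrite prodf_seq_neq0; apply/allP => j jl /=.
  apply/implyP => ji; rewrite subr_eq0; apply: contra ji => /eqP /xinj <- //.
pose q := \sum_(i <- l) (p.[x i] / \prod_(j <- l | j != i) (x i - x j)) *: w i.
have q_at i : i \in l -> q.[x i] = p.[x i].
  move=> il; rewrite horner_sum (bigD1_seq i) //= hornerZ.
  have -> : (w i).[x i] = \prod_(j <- l | j != i) (x i - x j).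
    by rewrite horner_prod; apply: eq_bigr => j _; rewrite hornerXsubC.
  rewrite divfK ?w_neq0 // big1_seq ?addr0 // => j /andP[ji jl].
  rewrite hornerZ horner_prod; apply/eqP; rewrite mulf_eq0; apply/orP; right.
  rewrite prodf_seq_eq0; apply/hasP; exists i; rewrite // eq_sym ji.
  by rewrite hornerXsubC subrr eqxx.
have sq : (size q <= size l)%N.
  apply: (leq_trans (size_sum _ _ _)); apply/bigmax_leqP_seq => i il _.
  by rewrite (leq_trans (size_scale_leq _ _)) // wE.
have pq : q = p.
  apply/eqP; rewrite -subr_eq0; apply/negPn/negP => nz.
  have : (size (map x l) < size (q - p)%R)%N.
    apply: max_poly_roots nz _ _; last by rewrite map_inj_in_uniq.
    apply/allP => _ /mapP[i il ->].
    by rewrite /root hornerD hornerN q_at // subrr.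
  rewrite size_map ltnNge => /negP; apply.
  by rewrite (leq_trans (size_polyD _ _)) // size_polyN geq_max sq.
rewrite -pq coef_sum; apply: eq_big_seq => i il; rewrite pq coefZ.
have /monicP : w i \is monic by apply: monic_prod_XsubC.
by rewrite /lead_coef wE // => ->; rewrite mulr1.
Qed.

(** Both sides obey the recursion [hsymS], and t = 0 is [lagrange_lead] for a pure power. The empty
    list with t = 0 is excluded: there the sum is 0 and [hsym] is 1. *)
Lemma sum_hsym l x t :
    uniq l -> {in l &, injective x} -> (0 < size l + t)%N ->
  \sum_(i <- l) x i ^+ ((size l).-1 + t) / \prod_(j <- l | j != i) (x i - x j)
    = hsym (map x l) t.
Proof.
elim: l t => [|i0 l IH] t ul xinj.
  by case: t => // t _; rewrite big_nil.
move=> _; elim: t => [|t IHt].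
  rewrite hsym0 addn0.
  have := @lagrange_lead _ _ 'X^(size l) ul xinj; rewrite size_polyXn => /(_ (leqnn _)).
  rewrite coefXn eqxx => E0; apply: etrans E0.
  by apply: eq_bigr => i _; rewrite hornerXn.
have [il ul'] : i0 \notin l /\ uniq l by move: ul => /= /andP[].
have xinj' : {in l &, injective x}.
  by move=> i j il' jl'; apply: xinj; rewrite inE ?il' ?jl' orbT.
(* Write x_i = x_i0 + (x_i - x_i0): the second summand cancels the factor of i0 in the denominator,
   and it vanishes for i = i0. *)
have E k : \sum_(i <- i0 :: l) x i ^+ k.+1 / \prod_(j <- i0 :: l | j != i) (x i - x j)
    = x i0 * (\sum_(i <- i0 :: l) x i ^+ k / \prod_(j <- i0 :: l | j != i) (x i - x j))
      + \sum_(i <- l) x i ^+ k / \prod_(j <- l | j != i) (x i - x j).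
  rewrite !big_cons eqxx mulrDr -addrA; congr (_ + _); first by rewrite exprS mulrA.
  rewrite mulr_sumr -big_split /=; apply: eq_big_seq => i il'.
  have i0i : i0 != i by apply: contraNneq il => ->.
  have x0i : x i - x i0 != 0.
    rewrite subr_eq0; apply: contraNneq i0i => /esym/xinj -> //;
    by rewrite inE ?eqxx ?il' ?orbT.
  rewrite big_cons i0i invfM exprS.
  by move: (\prod_(_ <- _ | _) _)^-1 => c; field.
rewrite addnS E IHt [map _ (_ :: _)]/= hsymS; congr (_ + _).
(* For nonempty [l] the exponent size l + t equals (size l).-1 + t.+1. For empty [l] it does not,
   but both sides are 0. *)
case: l IH il ul' xinj' {ul xinj IHt E} => [|i1 l] IH il ul' xinj'.
  by rewrite big_nil.
by rewrite -IH // ?addnS // addSn.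
Qed.

End Interpolation.

(** The factors with q < p give the sign and (p - m)!, those with q > p give (n - p)!. *)
Lemma prod_natr_sub (F : comPzRingType) (m p n : nat) : (m <= p <= n)%N ->
  \prod_(m <= q < n.+1 | q != p) (q%:R - p%:R : F)
    = (-1) ^+ (p - m) * ((p - m)`!%:R * (n - p)`!%:R).
Proof.
move=> /andP[mp pn]; rewrite big_mkcond (big_cat_nat mp (leqW pn)) /=.
rewrite (big_ltn (n := n.+1)) ?ltnS //= eqxx mul1r mulrA; congr (_ * _).
  rewrite fact_prod natr_prod big_add1 /=.
  rewrite -[p in LHS](subnK mp) -{1}[m]add0n big_addn addnK.
  have -> : (-1) ^+ (p - m) = \prod_(0 <= q < p - m) (-1 : F).
    by rewrite big_const_nat iter_mulr_1 subn0.
  rewrite -big_split /= [LHS]big_nat_rev /= add0n [LHS]big_nat [RHS]big_nat.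
  apply: eq_bigr => q /andP[_ qp].
  have le : (p - m - q.+1 + m <= p)%N by lia.
  rewrite ifT; last by apply/eqP; lia.
  rewrite mulN1r -opprB -natrB ?subnK //; congr (- _%:R); lia.
rewrite fact_prod natr_prod -[p.+1 in LHS]add1n -[n.+1 in LHS](subnK (leqW pn)).
rewrite big_addn addnK subSn // [LHS]big_nat [RHS]big_nat.
apply: eq_bigr => q /andP[q0 _].
rewrite ifT; last by apply/eqP; lia.
by rewrite natrD addrK.
Qed.

(** * The interpolation nodes and their differences *)

Section Nodes.
Variables (F : numFieldType) (L : nat).

(** k = 0 gives all nodes, for Theta_1; k = 1 leaves out p = 0, for Theta_2. *)
Definition node_index (k : nat) (n : 'I_L -> nat) : seq ('I_L * nat) :=
  [seq (r, p) | r <- index_enum 'I_L, p <- index_iota k (n r).+1].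

Variables (k : nat) (n : 'I_L -> nat).

Lemma node_index_uniq : uniq (node_index k n).
Proof.
apply: allpairs_uniq_dep => [|r _|[i p] [j q] _ _ /= [-> ->] //].
  exact: index_enum_uniq.
exact: iota_uniq.
Qed.

Lemma mem_node_index r p : ((r, p) \in node_index k n) = (k <= p <= n r)%N.
Proof.
apply/allpairsPdep/idP => [[i [q [_ + [-> ->]]]]|pr].
  by rewrite mem_index_iota ltnS.
by exists r, p; rewrite mem_index_enum mem_index_iota ltnS.
Qed.

Lemma size_node_index : size (node_index k n) = (\sum_(m < L) ((n m).+1 - k))%N.
Proof.
rewrite -sum1_size big_allpairs_dep; apply: eq_bigr => m _.
by rewrite sum1_size size_iota.
Qed.

Variables (u v : 'I_L -> F) (y : F).
Hypothesis u_neq0 : forall r, u r != 0.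

(* With [u r = z - a r], [v = sv] and [y = j s] these are the interpolation nodes
   (j s - p s_r) / (z - a_r); [cross] is the numerator of their differences. *)
Definition node (i : 'I_L * nat) : F := (y - i.2%:R * v i.1) / u i.1.

Definition cross (r : 'I_L) (p : nat) (m : 'I_L) (q : nat) : F :=
  u m * (y - p%:R * v r) - u r * (y - q%:R * v m).

Hypothesis v_neq0 : forall r, (0 < n r)%N -> v r != 0.
Hypothesis cross_neq0 : forall (r m : 'I_L) (p q : nat), m != r ->
  (k <= p <= n r)%N -> (k <= q <= n m)%N -> cross r p m q != 0.

Lemma node_sub r p m q :
  node (r, p) - node (m, q) = cross r p m q / (u m * u r).
Proof. by rewrite /node /cross /=; field; rewrite !u_neq0. Qed.

Lemma node_inj : {in node_index k n &, injective node}.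
Proof.
move=> [r p] [m q]; rewrite !mem_node_index => hp hq /eqP.
rewrite -subr_eq0 node_sub mulf_eq0 invr_eq0 mulf_eq0 !(negPf (u_neq0 _)) !orbF.
have [mr|mr] := eqVneq m r; last by rewrite (negPf (cross_neq0 _ _ _)).
subst m; have [->//|pq] := eqVneq p q.
(* For equal r the numerator is u_r (q - p) v_r, and two different indices in the range force n_r >
   0, hence v_r != 0. *)
rewrite /cross -mulrBr mulf_eq0 (negPf (u_neq0 _)) /= opprB addrC addrA subrK.
rewrite -mulrBl mulf_eq0 subr_eq0 eqr_nat eq_sym (negPf pq) /= => v0.
have : (0 < n r)%N by move: pq hp hq; lia.
by move=> /v_neq0; rewrite v0.
Qed.

Definition cross_prod r p : F :=
  \prod_(m < L | m != r) \prod_(k <= q < (n m).+1) cross r p m q.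

(** Nodes with the same r are equally spaced, which gives the factorials and the power of v_r / u_r;
    the other nodes give [cross_prod]. *)
Lemma node_prod r p : (k <= p <= n r)%N ->
  \prod_(i <- node_index k n | i != (r, p)) (node (r, p) - node i)
    = (-1) ^+ (p - k) * ((p - k)`!%:R * (n r - p)`!%:R)
      * (v r / u r) ^+ (n r - k)
      * (cross_prod r p / (\prod_(m < L | m != r) u m ^+ ((n m).+1 - k)
           * u r ^+ (\sum_(m < L | m != r) ((n m).+1 - k)))).
Proof.
move=> hp; rewrite big_mkcond big_allpairs_dep (bigD1 r) //=; congr (_ * _).
  rewrite -prod_natr_sub // -[RHS]mulr1.
  under eq_bigr => q _ do rewrite xpair_eqE eqxx /=.
  rewrite -big_mkcond /=.
  have -> : (v r / u r) ^+ (n r - k) = \prod_(k <= q < (n r).+1 | q != p) (v r / u r).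
    rewrite big_const_seq iter_mulr_1; congr (_ ^+ _).
    rewrite -size_filter -rem_filter ?iota_uniq // size_rem ?size_iota.
      by rewrite subSn; lia.
    by rewrite mem_index_iota ltnS.
  rewrite mulr1 -big_split /=; apply: eq_bigr => q _.
  by rewrite node_sub /cross; field; rewrite u_neq0.
rewrite /cross_prod -prodrXr -!big_split /= -prodf_div; apply: eq_bigr => m mr.
under eq_bigr => q _ do rewrite xpair_eqE (negPf mr) /= node_sub.
rewrite prodf_div; congr (_ / _).
by rewrite big_const_seq iter_mulr_1 count_predT size_iota exprMn.
Qed.

(** The powers of u_r cancel down to u_r^(-t). Completing the product over m != r to all m makes the
    prefactor independent of r and p; for k = 0 it is 1/h(z). *)
Lemma node_term r p t : (k <= p <= n r)%N ->
  node (r, p) ^+ ((size (node_index k n)).-1 + t)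
    / \prod_(i <- node_index k n | i != (r, p)) (node (r, p) - node i)
  = \prod_(m < L) u m ^+ ((n m).+1 - k)
    * ((y - p%:R * v r) ^+ ((size (node_index k n)).-1 + t)
       / ((p - k)`!%:R * (n r - p)`!%:R) * (-1) ^+ (p - k) / cross_prod r p
       / (v r ^+ (n r - k) * u r ^+ ((n r).+1 - k + t))).
Proof.
move=> hp; rewrite node_prod // size_node_index.
rewrite (bigD1 r) //= [\prod_(m < L) _](bigD1 r) //=.
set A := \prod_(_ < _ | _) _; set K := (\sum_(_ < _ | _) _)%N.
have -> : ((n r).+1 - k = (n r - k).+1)%N by lia.
rewrite addSn /=; move: (n r - k)%N => e.
have A0 : A != 0 by apply/prodf_neq0 => m _; rewrite expf_neq0.
rewrite /node /= !expr_div_n; set W := (y - _) ^+ _.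
rewrite !invfM invr_sign !invrK !exprD exprS.
have : u r ^+ e != 0 by rewrite expf_neq0.
have : u r ^+ K != 0 by rewrite expf_neq0.
have : u r ^+ t != 0 by rewrite expf_neq0.
have := u_neq0 r; move: W => W.
move: (u r ^+ e) (u r ^+ K) (u r ^+ t) (u r) => ue uK ut ur *.
move: (cross_prod r p)^-1 (_`!%:R^-1) (_`!%:R^-1) (v r ^- e) => c1 c2 c3 c4.
by field; do ?[apply/andP; split].
Qed.

Lemma sum_node_hsym t : (0 < size (node_index k n) + t)%N ->
  \sum_(r < L) \sum_(k <= p < (n r).+1)
     ((y - p%:R * v r) ^+ ((size (node_index k n)).-1 + t)
       / ((p - k)`!%:R * (n r - p)`!%:R) * (-1) ^+ (p - k) / cross_prod r p
       / (v r ^+ (n r - k) * u r ^+ ((n r).+1 - k + t)))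
  = hsym [seq node i | i <- node_index k n] t
    / \prod_(m < L) u m ^+ ((n m).+1 - k).
Proof.
move=> size_t; apply: (canRL (mulfK _)).
  by apply/prodf_neq0 => m _; rewrite expf_neq0.
rewrite -sum_hsym ?node_index_uniq //; last exact: node_inj.
rewrite mulrC big_allpairs_dep mulr_sumr; apply: eq_bigr => r _.
rewrite mulr_sumr; apply: eq_big_seq => p; rewrite mem_index_iota ltnS => hp.
by rewrite node_term.
Qed.

End Nodes.

(** * Higher derivatives of h *)

Section Derivatives.
Variable F : numFieldType.
Implicit Types (b : seq F) (c w : F).

(** Off the poles this is the t-th derivative of the product of the 1/(w - c), divided by (-1)^t t!;
    [b] lists the poles with multiplicity. *)
Definition pole_hsym b (t : nat) (w : F) : F :=
  \prod_(c <- b) (w - c)^-1 * hsym [seq (w - c)^-1 | c <- b] t.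

Lemma pole_hsym_cons0 c b w :
  pole_hsym (c :: b) 0 w = (w - c)^-1 * pole_hsym b 0 w.
Proof. by rewrite /pole_hsym !hsym0 big_cons mulrA. Qed.

Lemma pole_hsym_consS c b t w :
  pole_hsym (c :: b) t.+1 w
    = (w - c)^-1 * (pole_hsym (c :: b) t w + pole_hsym b t.+1 w).
Proof. by rewrite /pole_hsym [map _ (_ :: _)]/= hsymS !big_cons; ring. Qed.

Lemma is_derive_inv_sub c w : w != c ->
  is_derive w 1 (fun x : F => (x - c)^-1 : F^o) (- (w - c)^-1 ^+ 2).
Proof.
move=> wc; have wc0 : w - c != 0 by rewrite subr_eq0.
have d : is_derive w 1 (fun x : F => x - c : F^o) 1.
  have : is_derive w 1 (id - cst c : F -> F^o) (1 - 0 : F^o) by exact: is_deriveB.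
  by rewrite subr0.
have [dx dE] := d.
apply: DeriveDef; first exact: derivableV.
by rewrite deriveV // dE exprVn /GRing.scale /= mulr1.
Qed.

Lemma is_derive_pole_hsym b t w : (forall c, c \in b -> w != c) ->
  is_derive w 1 (pole_hsym b t : F -> F^o) (- (t.+1%:R * pole_hsym b t.+1 w)).
Proof.
elim: b t => [|c b IH] t wb.
  have -> : pole_hsym [::] t = cst (t == 0)%:R.
    by apply/funext => x; rewrite /pole_hsym big_nil mul1r.
  rewrite /pole_hsym /= !mulr0 oppr0; exact: is_derive_cst.
have wc : w != c by rewrite wb ?mem_head.
have {}IH t' := IH t' (fun x xb => wb x (@mem_behead _ (c :: b) x xb)).
elim: t => [|t IHt].
  have -> : pole_hsym (c :: b) 0 = (fun x => (x - c)^-1) * pole_hsym b 0.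
    by apply/funext => x; rewrite pole_hsym_cons0.
  have := is_deriveM (is_derive_inv_sub wc) (IH 0%N); congr (is_derive _ _ _ _).
  by rewrite /GRing.scale /= pole_hsym_consS pole_hsym_cons0; ring.
have -> : pole_hsym (c :: b) t.+1
    = (fun x => (x - c)^-1) * (pole_hsym (c :: b) t + pole_hsym b t.+1).
  by apply/funext => x; rewrite pole_hsym_consS.
have := is_deriveM (is_derive_inv_sub wc) (is_deriveD IHt (IH t.+1)).
congr (is_derive _ _ _ _).
(* With D = 1/(w - c) and G, B the functions for c :: b and b, the Leibniz rule gives -D G_(t+1) - D
   ((t+1) G_(t+1) + (t+2) B_(t+2)), which is -(t+2) G_(t+2). *)
rewrite /GRing.scale /= fctE (pole_hsym_consS c b t.+1) (pole_hsym_consS c b t).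
by rewrite -[t.+2%:R]natr1; ring.
Qed.

Lemma near_notin b w : (forall c, c \in b -> w != c) ->
  \forall x \near (w : F^o), forall c, c \in b -> x != c.
Proof.
elim: b => [|c b IH] wb; first by near=> x => c; rewrite in_nil.
have wc : w - c != 0 by rewrite subr_eq0 wb ?mem_head.
have near1 : \forall x \near (w : F^o), x - c != 0.
  have cw := cvgB (FF := nbhs_filter _) (@cvg_id _ (nbhs (w : F^o)))
    (@cvg_cst F^o c _ _ (nbhs_filter (w : F^o))).
  exact: (cvgr_neq0 (FF := nbhs_filter _) _ cw wc).
have near2 := IH (fun x xb => wb x (@mem_behead _ (c :: b) x xb)).
near=> x => c'; rewrite inE => /orP[/eqP ->|].
  by rewrite -subr_eq0; near: x.
by move: c'; near: x.
Unshelve. all: by end_near.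
Qed.

Lemma derive1n_pole_hsym b t w : (forall c, c \in b -> w != c) ->
  derive1n t (pole_hsym b 0 : F -> F^o) w = (-1) ^+ t * t`!%:R * pole_hsym b t w.
Proof.
elim: t w => [|t IH] w wb; first by rewrite expr0 fact0 !mul1r.
rewrite derive1nS derive1E.
(* The formula of order t is known only off the poles, hence on a neighbourhood of w, which suffices
   to differentiate at w. *)
rewrite (@near_eq_derive _ _ _ _
  (((-1) ^+ t * t`!%:R) *: (pole_hsym b t : F -> F^o))); last first.
  by have := near_notin wb; apply: filterS => x xb; rewrite IH.
have [dx dE] := is_derive_pole_hsym t wb.
rewrite deriveZ // dE.
by rewrite /GRing.scale /= exprS factS natrM; ring.
Qed.

End Derivatives.

(** This N-th finite difference is [lagrange_lead] at the nodes 0, ..., N; the denominators come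
    from [prod_natr_sub] after reversing N differences. *)
Lemma sum_alternating_poly (F : numFieldType) (N : nat) (p : {poly F}) :
  (size p <= N.+1)%N ->
  \sum_(0 <= j < N.+1) (-1) ^+ j / (j`!%:R * (N - j)`!%:R) * p.[j%:R]
    = (-1) ^+ N * p`_N.
Proof.
move=> sp; set l := index_iota 0 N.+1.
have sl : size l = N.+1 by rewrite size_iota subn0.
have inj : {in l &, injective (fun j => j%:R : F)}.
  by move=> i j _ _ /eqP; rewrite eqr_nat => /eqP.
have := lagrange_lead (iota_uniq _ _) inj; rewrite sl => /(_ p sp) /= <-.
rewrite mulr_sumr; apply: eq_big_seq => j jl.
have jN : (0 <= j <= N)%N by move: jl; rewrite mem_index_iota ltnS.
have -> : \prod_(i <- l | i != j) (j%:R - i%:R) = (-1) ^+ N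
    * \prod_(0 <= i < N.+1 | i != j) (i%:R - j%:R : F).
  have -> : (-1) ^+ N = \prod_(0 <= i < N.+1 | i != j) (-1 : F).
    rewrite big_const_seq iter_mulr_1 -size_filter -rem_filter ?iota_uniq //.
    by rewrite size_rem ?size_iota ?subn0.
  by rewrite -big_split /=; apply: eq_bigr => i _; rewrite mulN1r opprB.
rewrite prod_natr_sub // subn0; set c := _ * _%:R.
by rewrite [((-1) ^+ N * _)^-1]invfM [(_ * c)^-1]invfM !invr_sign mulrCA signrMK mulrC.
Qed.

(** * The sums over Theta_1 and Theta_2 as values of H_t *)

Section ThetaSums.
Variables (F : numFieldType) (L : nat) (a sv : 'I_L -> F) (n : 'I_L -> nat).
Variables (s z : F).
Hypothesis z_neq : forall i, z != a i.
Hypothesis sv_eq0 : forall i, sv i = 0 <-> n i = 0%N.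

Let u r := z - a r.

Let u_neq0 r : u r != 0. Proof. by rewrite subr_eq0. Qed.

Let sv_neq0 r : (0 < n r)%N -> sv r != 0.
Proof. by rewrite lt0n; apply: contra => /eqP /sv_eq0 ->. Qed.

(** This is [sum_node_hsym] at k = 0, y = j s. There are n_1 + ... + n_L + L nodes, whence the
    exponent in Theta_1. *)
Lemma sum_Theta1 t j : (0 < L)%N ->
  (forall (r m : 'I_L) (p q : nat), m != r -> (p <= n r)%N -> (q <= n m)%N ->
     (z - a m) * (j%:R * s - p%:R * sv r)
       - (z - a r) * (j%:R * s - q%:R * sv m) != 0) ->
  \sum_(r < L) (1 / (sv r ^+ n r * (z - a r) ^+ (n r + 1 + t))
                * \sum_(0 <= p < (n r).+1) Theta1 a n sv s z t j r p)
  = hfun a n z * hsym [seq node u sv (j%:R * s) i | i <- node_index 0 n] t.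
Proof.
move=> L_gt0 cross0.
have sz : size (node_index 0 n) = (\sum_(m < L) n m + L)%N.
  rewrite size_node_index; under eq_bigr do rewrite subn0 -addn1.
  by rewrite big_split /= sum1_card card_ord.
rewrite mulrC /hfun div1r.
have := @sum_node_hsym _ _ 0 n u sv (j%:R * s) u_neq0 sv_neq0 cross0 t.
rewrite sz => <-; last by rewrite !addn_gt0 L_gt0 orbT.
apply: eq_bigr => r _; rewrite mulr_sumr; apply: eq_bigr => p _.
rewrite /Theta1 /cross_prod !subn0 addn1 -subn1.
under [X in _ * (_ * X)]eq_bigr do
  (under eq_bigr do rewrite div1r; rewrite prodfV).
rewrite prodfV div1r; set c := (\prod_(_ < _ | _) _)^-1.
by rewrite mulrC.
Qed.

Lemma sum_Theta2 t : (0 < \sum_(m < L) n m + t)%N ->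
  (forall (r m : 'I_L) (p q : nat), m != r ->
     (1 <= p <= n r)%N -> (1 <= q <= n m)%N ->
     q%:R * sv m * (z - a r) - p%:R * sv r * (z - a m) != 0) ->
  (\prod_(m < L) (1 / (z - a m))) * (-1) ^+ (\sum_(m < L) n m + t)
    * \sum_(r < L | (1 <= n r)%N)
        (sv r ^+ (\sum_(m < L | m != r) n m + t) * (1 / (z - a r) ^+ (n r + t))
         * \sum_(1 <= p < (n r).+1) Theta2 a n sv z t r p)
  = hfun a n z * hsym [seq node u sv 0 i | i <- node_index 0 n] t.
Proof.
move=> D_gt0 cross0.
have sz : size (node_index 1 n) = (\sum_(m < L) n m)%N.
  by rewrite size_node_index; under eq_bigr do rewrite subn1.
have crossE r p m q : cross u sv 0 r p m q
    = q%:R * sv m * (z - a r) - p%:R * sv r * (z - a m).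
  by rewrite /cross /u; ring.
have cross1 (r m : 'I_L) p q : m != r -> (1 <= p <= n r)%N ->
    (1 <= q <= n m)%N -> cross u sv 0 r p m q != 0.
  by move=> *; rewrite crossE cross0.
(* The nodes with [p = 0] vanish and do not contribute to [hsym]. *)
have -> : hsym [seq node u sv 0 i | i <- node_index 0 n] t
    = hsym [seq node u sv 0 i | i <- node_index 1 n] t.
  rewrite -[LHS]hsym_filter0; congr (hsym _ _); rewrite filter_map; congr map.
  rewrite /node_index filter_flatten -map_comp; congr flatten.
  apply: eq_map => r /=; rewrite filter_map.
  rewrite /node /= mul0r subr0 mul0r eqxx /= /index_iota subn1 /=.
  congr (map _ _); apply/all_filterP/allP => p; rewrite mem_iota => hp /=.
  rewrite sub0r mulf_neq0 ?invr_eq0 // oppr_eq0 mulf_neq0 ?sv_neq0 ?pnatr_eq0 //.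
    by move: hp; lia.
  by move: hp; lia.
(* For k = 1 the prefactor has one factor u_m less for each m; these form the product of the 1/(z -
   a_m) in (II). *)
have -> : hfun a n z = \prod_(m < L) (1 / (z - a m))
    / \prod_(m < L) u m ^+ ((n m).+1 - 1).
  rewrite /hfun -prodf_div div1r -prodfV; apply: eq_bigr => m _.
  by rewrite subn1 exprS invfM div1r.
rewrite -!mulrA; congr (_ * _); rewrite [RHS]mulrC.
have := @sum_node_hsym _ _ 1 n u sv 0 u_neq0 sv_neq0 cross1 t.
rewrite sz => <- //.
rewrite mulr_sumr big_mkcond; apply: eq_bigr => r _ /=.
case: ltnP => [nr|]; last first.
  by rewrite leqn0 => /eqP ->; rewrite big_geq.
rewrite !mulr_sumr; apply: eq_big_nat => p /andP[p_gt0 pn].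
have -> : cross_prod 1 n u sv 0 r p = (\prod_(m < L | m != r)
    \prod_(1 <= q < (n m).+1)
       (1 / (q%:R * sv m * (z - a r) - p%:R * sv r * (z - a m))))^-1.
  rewrite /cross_prod -prodfV; apply: eq_bigr => m _.
  by rewrite -prodfV; apply: eq_bigr => q _; rewrite crossE div1r invrK.
rewrite /Theta2 invrK; set c := \prod_(_ < _ | _) _.
have -> : (\sum_(m < L) n m + t = n r + (\sum_(m < L | m != r) n m + t))%N.
  by rewrite (bigD1 r) //= addnA.
have -> : ((\sum_(m < L) n m).-1 + t
    = (n r).-1 + (\sum_(m < L | m != r) n m + t))%N.
  by rewrite (bigD1 r) //= -(prednK nr) addSn /= addnA.
move: (_ + t)%N => K.
have sv0 := sv_neq0 nr; have u0 := u_neq0 r; rewrite -/(u r).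
have -> : ((n r).+1 - 1 = n r)%N by rewrite subn1.
have ut0 : u r ^+ (n r + t) != 0 by rewrite expf_neq0.
move: (u r ^+ (n r + t)) ut0 => U U0.
(* With D the sum of the n_m, (-p s_r)^(D-1+t) / s_r^(n_r-1) leaves the required power of s_r, and
   1/(p-1)! = p/p! raises the power of p to D + t. The sign becomes (-1)^(D+t+p). *)
case: p p_gt0 pn c => // p _ pn c; have p0 : (p.+1%:R : F) != 0 by rewrite pnatr_eq0.
have -> : n r = (n r).-1.+1 by rewrite prednK.
rewrite !subn1 /= sub0r -[- (_ * sv r)]mulN1r !exprMn !exprD factS natrM !exprS.
have fact_neq0 k : (k`!%:R : F) != 0 by rewrite pnatr_eq0 -lt0n fact_gt0.
have sve0 : sv r ^+ (n r).-1 != 0 by rewrite expf_neq0.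
move: (_`!%:R) (_`!%:R) (fact_neq0 p) (fact_neq0 ((n r).-1 - p)%N).
move: (sv r ^+ (n r).-1) sve0 (p.+1%:R) p0 => S S0 P P0 f1 f2 f10 f20.
by field; rewrite f10 f20 S0 P0 U0.
Qed.

(** The list repeats each a_r as often as its order n_r + 1. At a pole both sides are 0, since 0^-1
    = 0. *)
Lemma hfun_pole_hsym : hfun a n = pole_hsym [seq a i.1 | i <- node_index 0 n] 0.
Proof.
apply/funext => w; rewrite /hfun /pole_hsym hsym0 mulr1 big_map.
rewrite big_allpairs_dep div1r -prodfV; apply: eq_bigr => m _ /=.
by rewrite big_const_seq iter_mulr_1 count_predT size_iota subn0 exprVn.
Qed.

(* The nodes at [y = j s] are the values at [j] of degree one polynomials with
   leading coefficients [s / (z - a r)]. *)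
Lemma node_poly t : exists P : {poly F},
  [/\ (size P <= t.+1)%N,
      s ^+ t * derive1n t (hfun a n : F -> F^o) z
        = (-1) ^+ t * t`!%:R * hfun a n z * P`_t &
      forall j : nat, P.[j%:R]
        = hsym [seq node u sv (j%:R * s) i | i <- node_index 0 n] t].
Proof.
pose l := [seq (s / u i.1, - (i.2%:R * sv i.1) / u i.1) | i <- node_index 0 n].
have [sP cP] := coef_hsym_affine l t.
exists (hsym [seq x.1 *: 'X + x.2%:P | x <- l] t); split => // [|j].
  have pole c : c \in [seq a i.1 | i <- node_index 0 n] -> z != c.
    by move=> /mapP[i _ ->].
  rewrite hfun_pole_hsym derive1n_pole_hsym // cP.
  (* The slopes s / (z - a_r) are s times the arguments of H_t in h^(t)(z), so [hsym_scale] produces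
     s^t. *)
  have -> : [seq x.1 | x <- l]
      = [seq s * x | x <- [seq (z - c)^-1 | c <- [seq a i.1 | i <- node_index 0 n]]].
    by rewrite -!map_comp.
  by rewrite hsym_scale /pole_hsym hsym0; ring.
(* Evaluation at j is a ring morphism, so it commutes with [hsym]. *)
rewrite -[LHS]/(horner_eval j%:R _) rmorph_hsym -!map_comp.
congr (hsym _ _); apply: eq_map => i /=.
by rewrite /horner_eval hornerD hornerZ hornerX hornerC /node; ring.
Qed.

End ThetaSums.

(** * Finite differences in j give (I) and (II) *)

Theorem theorem3p1 (R : realType) (L : nat) (hL : (1 <= L)%N)
    (a : 'I_L -> R[i]) (a_inj : injective a)
    (n : 'I_L -> nat)
    (z : R[i]) (hz : forall i, z != a i)
    (sv : 'I_L -> R[i]) (s : R[i]) (hs : s != 0)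
    (hsv : forall i, sv i = 0 <-> n i = 0%N)
    (t : nat) :
  (forall N : nat, (t.+1 <= N)%N ->
    (forall (j : nat) (r m : 'I_L) (p q : nat),
        (1 <= j <= N)%N -> m != r -> (p <= n r)%N -> (q <= n m)%N ->
        (z - a m) * (j%:R * s - p%:R * sv r)
          - (z - a r) * (j%:R * s - q%:R * sv m) != 0) ->
    derive1n t (hfun a n : R[i] -> R[i]^o) z =
      t`!%:R / s ^+ t * (-1) ^+ (N + t)
      * \sum_(1 <= j < N.+1)
          (j%:R ^+ (N - t) / (j`!%:R * (N - j)`!%:R) * (-1) ^+ j
           * \sum_(r < L)
               (1 / (sv r ^+ n r * (z - a r) ^+ (n r + 1 + t))
                * \sum_(0 <= p < (n r).+1) Theta1 a n sv s z t j r p)))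
  /\
  ((1 <= (\sum_(m < L) n m) + t)%N ->
    (forall (j : nat) (r m : 'I_L) (p q : nat),
        (1 <= j <= t)%N -> m != r -> (p <= n r)%N -> (q <= n m)%N ->
        (z - a m) * (j%:R * s - p%:R * sv r)
          - (z - a r) * (j%:R * s - q%:R * sv m) != 0) ->
    (forall (r m : 'I_L) (p q : nat),
        m != r -> (1 <= p <= n r)%N -> (1 <= q <= n m)%N ->
        q%:R * sv m * (z - a r) - p%:R * sv r * (z - a m) != 0) ->
    derive1n t (hfun a n : R[i] -> R[i]^o) z =
      1 / s ^+ t * (\prod_(m < L) (1 / (z - a m)))
        * (-1) ^+ ((\sum_(m < L) n m) + t)%N
        * \sum_(r < L | (1 <= n r)%N)
            (sv r ^+ ((\sum_(m < L | m != r) n m) + t)%N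
             * (1 / (z - a r) ^+ (n r + t))
             * \sum_(1 <= p < (n r).+1) Theta2 a n sv z t r p)
      + t`!%:R / s ^+ t
        * \sum_(1 <= j < t.+1)
            ((-1) ^+ j / (j`!%:R * (t - j)`!%:R)
             * \sum_(r < L)
                 (1 / (sv r ^+ n r * (z - a r) ^+ (n r + 1 + t))
                  * \sum_(0 <= p < (n r).+1) Theta1 a n sv s z t j r p))).

Proof.
have [P [sP dP eP]] := node_poly sv n s hz t.
have st0 : s ^+ t != 0 by rewrite expf_neq0.
have dE : derive1n t (hfun a n : R[i] -> R[i]^o) z
    = t`!%:R / s ^+ t * (-1) ^+ t * (hfun a n z * P`_t).
  by apply: (mulfI st0); rewrite dP; field.
have sign_sq k : (-1) ^+ k * (-1) ^+ k = 1 :> R[i] by rewrite -expr2 sqrr_sign.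
rewrite dE {dP dE}; split=> [N tN cross0|D_gt0 cross0 cross1].
  have XPN : P`_t = ('X^(N - t) * P)`_N.
    by rewrite coefXnM ltnNge leq_subr /= subKn // ltnW.
  have sXP : (size ('X^(N - t) * P)%R <= N.+1)%N.
    rewrite (leq_trans (size_polyMleq _ _)) // size_polyXn addSn /=.
    by rewrite (leq_trans (leq_add (leqnn (N - t)) sP)) // addnS subnK // ltnW.
  have := sum_alternating_poly sXP.
  (* Since N > t, the factor j^(N-t) removes the term j = 0. *)
  rewrite big_ltn // hornerM hornerXn expr0n subn_eq0 leqNgt tN mul0r mulr0 add0r.
  rewrite -XPN => E.
  set S := \sum_(1 <= j < N.+1) _.
  have -> : S = hfun a n z * ((-1) ^+ N * P`_t).
    rewrite -E mulr_sumr; apply: eq_big_nat => j jN.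
    rewrite (sum_Theta1 hz hsv) // => [|r m p q]; last exact: cross0.
    by rewrite -eP hornerM hornerXn; ring.
  rewrite exprD -[LHS]mulr1 -[X in _ * X = _](sign_sq N); ring.
have P0 : hsym [seq node (fun r => z - a r) sv 0 i | i <- node_index 0 n] t = P.[0].
  by rewrite (eP 0%N) mul0r.
rewrite -!(mulrA (1 / s ^+ t)) (sum_Theta2 hz hsv) // P0.
set S := \sum_(1 <= j < t.+1) _.
have E := sum_alternating_poly sP; rewrite big_ltn // in E.
(* The full sum over 0 <= j <= t is (-1)^t P_t; its term j = 0 is P(0)/t!, which the Theta_2 part
   restores. *)
have -> : S = hfun a n z * ((-1) ^+ t * P`_t - t`!%:R^-1 * P.[0]).
  rewrite -E fact0 subn0 expr0 !mul1r addrC addKr mulr_sumr.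
  apply: eq_big_nat => j jt.
  rewrite (sum_Theta1 hz hsv) // => [|r m p q]; last exact: cross0.
  by rewrite -eP; ring.
have ft0 : (t`!%:R : R[i]) != 0 by rewrite pnatr_eq0 -lt0n fact_gt0.
by field; rewrite ft0 st0.
Qed.
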